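(* Let $\varepsilon\to 0$ with $\varepsilon>0$, and let either $\sigma/\varepsilon\to 0$ or $\sigma=0$. Then the asymptotic probabilities of the exit positions are $$\mathbb{P}(\tau=\tau^i)\to\begin{cases}1 & i=d,\\ 0 & 1\le i\le d-1.\end{cases}$$ Further, $$\tau=t_\ast-\frac{(d-1)(2d-1)}{6}+o_P(1).$$
   Context: Let $d\ge 1$ be a fixed integer, and let $\sigma\ge 0$, $\varepsilon>0$. The positions $X^0_t,\dots,X^d_t$ ($t\ge 0$) of $d+1$ particles on the real line are given by the system $$X_0^i=i\ (i=0,\dots,d);\qquad X_t^0=0,\quad X_t^d=d+\varepsilon t\ (t\ge 0);$$ $$\mathrm{d}X_t^i=(X_t^{i+1}+X_t^{i-1}-2X_t^i)\,\mathrm{d}t+\sigma\,\mathrm{d}B_t^i,\qquad i=1,\dots,d-1,\ t\ge 0,$$ where $(B^i_t)_{t\ge 0}$, $i=1,\dots,d-1$, are independent standard Brownian motions. For $i\in\{1,\dots,d\}$ put $$\tau^i:=\inf\{t\ge 0: X_t^i-X_t^{i-1}=2\},\qquad \tau:=\min_{1\le i\le d}\tau^i,\qquad t_\ast:=\frac{d}{\varepsilon}.$$ The notation $o_P(1)$ denotes a random quantity converging to $0$ in probability in the stated limit. *)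

(* Defs.v *)
From HB Require Import structures.
From mathcomp Require Import all_boot all_order all_algebra.
From mathcomp Require Import all_classical all_reals all_analysis.

Set Implicit Arguments.
Unset Strict Implicit.
Unset Printing Implicit Defensive.

Import Order.TTheory GRing.Theory Num.Theory.
Import numFieldNormedType.Exports.

Local Open Scope classical_set_scope.
Local Open Scope ring_scope.

Section processes.
Context {R : realType} {disp : measure_display} {T : measurableType disp}.
Variable P : probability T R.

Definition increment (W : R -> {RV P >-> R}) (s t : R) : T -> R :=
  fun w => W t w - W s w.

(* Times are all of R for convenience; only nonnegative times are
   constrained. Gaussian increments are required for s < t only, since
   [normal_prob] with zero standard deviation is not a point mass. *)
Definition standard_brownian_motion (W : R -> {RV P >-> R}) : Prop :=
  [/\ {ae P, forall w, W 0 w = 0},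
      forall s t : R, 0 <= s -> s < t ->
        forall A : set R, measurable A ->
          P (increment W s t @^-1` A) = normal_prob 0 (Num.sqrt (t - s)) A,
      forall (n : nat) (t : nat -> R) (A : nat -> set R),
        0 <= t 0%N ->
        (forall k l : nat, (k <= l)%N -> t k <= t l) ->
        (forall k : nat, measurable (A k)) ->
        P (\bigcap_(k in [set k | (k < n)%N])
             (increment W (t k) (t k.+1) @^-1` A k)) =
        (\prod_(0 <= k < n) P (increment W (t k) (t k.+1) @^-1` A k))%E &
      {ae P, forall w, {within `[(0 : R), +oo[, continuous (fun t : R => W t w)}}].

Definition process_sigma_algebra (W : R -> {RV P >-> R}) : set (set T) :=
  <<s [set E | exists t : R, exists A : set R,
         [/\ 0 <= t, measurable A & E = W t @^-1` A]] >>.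

(* The product rule is stated for the full index range only; subfamilies are
   obtained by taking some of the events [E i] to be the whole space. *)
Definition independent_processes (m n : nat)
    (W : nat -> R -> {RV P >-> R}) : Prop :=
  forall E : nat -> set T,
    (forall i : nat, (m <= i < n)%N -> process_sigma_algebra (W i) (E i)) ->
    P (\bigcap_(i in [set i | (m <= i < n)%N]) E i) =
    (\prod_(m <= i < n) P (E i))%E.

Definition independent_brownian_motions (m n : nat)
    (W : nat -> R -> {RV P >-> R}) : Prop :=
  (forall i : nat, (m <= i < n)%N -> standard_brownian_motion (W i)) /\
  independent_processes m n W.

(* The noise being additive, the stochastic differential equation is, by
   definition, the pathwise integral equation below: the Ito integral of the
   constant [sigma] is [sigma * (B i t - B i 0)], and B i 0 = 0.
   All paths of [X] are continuous (so that exit events are measurable),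
   whereas the equations hold almost surely. Only the positions [X i] with
   i <= d and the noises [B i] with 1 <= i < d play a role. *)
Definition particle_system (d : nat) (sigma eps : R)
    (B X : nat -> R -> {RV P >-> R}) : Prop :=
  (forall (i : nat) (w : T), (i <= d)%N ->
     {within `[(0 : R), +oo[, continuous (fun t : R => X i t w)}) /\
  {ae P, forall w,
    [/\ forall i : nat, (i <= d)%N -> X i 0 w = i%:R,
        forall t : R, 0 <= t -> X 0%N t w = 0,
        forall t : R, 0 <= t -> X d t w = d%:R + eps * t &
        forall (i : nat) (t : R), (1 <= i < d)%N -> 0 <= t ->
          X i t w = X i 0 w
            + \int[lebesgue_measure]_(s in `[0, t])
                (X i.+1 s w + X i.-1 s w - 2 * X i s w)
            + sigma * B i t w]}.

(* Extended-real valued, with value +oo when the gap never equals 2. *)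
Definition exit_time_at (X : nat -> R -> {RV P >-> R}) (i : nat) (w : T)
    : \bar R :=
  ereal_inf [set t%:E | t in [set t : R | 0 <= t /\ X i t w - X i.-1 t w = 2]].

Definition exit_time (d : nat) (X : nat -> R -> {RV P >-> R}) (w : T)
    : \bar R :=
  (\big[Order.min/+oo]_(1 <= i < d.+1) exit_time_at X i w)%E.

End processes.

(* Convergence to 0 in probability, along a filter [F], of a family of random
   quantities that may live on different probability spaces. *)
Definition cvg_in_probability_to_0 {R : realType} {disp : measure_display}
    {I : Type} (F : set_system I) (T : I -> measurableType disp)
    (P : forall e : I, probability (T e) R)
    (Y : forall e : I, T e -> \bar R) : Prop :=
  forall eta : R, 0 < eta ->
    P e [set w | (eta%:E < `|Y e w|)%E] @[e --> F] --> 0%E.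

(* Main.v *)
Require Import Defs.
From HB Require Import structures.
From mathcomp Require Import all_boot all_order all_algebra.
From mathcomp Require Import all_classical all_reals all_analysis.
From mathcomp Require Import measurable_realfun ring lra zify.

(** The system is a discrete heat equation driven by its right end point, and
    for a slow driving speed [eps] it follows a quasi-static profile.  The
    profile
      q_i(t) = i + eps * (i t / d + c_i),   c_i = (i^3 - d^2 i) / (6 d),
    solves the noiseless equation with the right boundary values, so the
    deviation U_i = X_i - q_i solves the heat equation with zero boundary values
    and additive noise.  Along the profile, the i-th gap exceeds 2 when
      t > d / eps - (3 i^2 - 3 i + 1 - d^2) / 6,
    which happens first for i = d, at d / eps - (d - 1) (2 d - 1) / 6, and at
    least one time unit later for every other i.  All gaps grow at speed
    eps / d, so it remains to see that the deviation at time t is at most a small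
    multiple of eps * (A + (d / eps - t)), for a constant A: this neither moves
    the exit time by a fixed amount nor creates an earlier exit.  Allowing the
    bound to grow with the distance to d / eps is essential, since over a time
    of order 1 / eps the noise may well exceed eps.

    Deterministic part ([comparison], [barrier_step], [flow_bound]).  On a unit
    interval of time, the parabola i (d - i), whose discrete Laplacian is -2,
    times a decreasing affine function of time is a supersolution, provided that
    the noise oscillates on this interval by at most a fraction of the size of
    the barrier.  The minimum principle then shows that one unit of time shrinks
    the barrier by a fixed factor, more than is needed to absorb the noise and
    to follow the affine decrease of eps * (A + (J - j)) at integer times j.  The
    initial deviation is O(eps) and lies below the barrier, because
    J ~ d / eps is large.

    Probabilistic part ([brownian_oscillation], [noise_small]).  The oscillation
    of a Brownian motion on a unit interval exceeds y with probability O(y^-4),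
    by chaining over dyadic points with the Gaussian tails of the increments.  The allowed oscillation on the interval k units before the end is
    of order eps * (k + 1) / sigma, and the sum over k of (eps (k + 1) / sigma)^-4
    is O((sigma / eps)^4), which tends to 0.

    The statements concern probabilities of events defined by infima of hitting
    sets, which are measurable because all paths are continuous
    ([measurable_hitting_time]). *)

Set Implicit Arguments.
Unset Strict Implicit.
Unset Printing Implicit Defensive.
Import Order.TTheory GRing.Theory Num.Theory.
Import numFieldNormedType.Exports.
Local Open Scope classical_set_scope.
Local Open Scope ring_scope.

(** * Increments of an integral with continuous integrand *)

Lemma within_itv0y_dist (R : realType) (f : R -> R) (t e : R) :
  {within `[0, +oo[, continuous f} -> 0 <= t -> 0 < e ->
  exists2 dl : R, 0 < dl &
    forall s, 0 <= s -> `|s - t| < dl -> `|f s - f t| < e.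
Proof.
move=> /subspace_continuousP/(_ t) cf t0 e0.
have /cf : [set` `[0, +oo[] t by rewrite /= in_itv /= t0.
move=> /(@cvgrPdist_lt _ R^o)/(_ e e0).
rewrite /prop_near1 /within /= => /nbhs_ballP[dl/= dl0 H].
exists dl => // s s0 st; rewrite distrC; apply: H; rewrite /ball/=.
  by rewrite distrC.
by rewrite in_itv/= s0.
Qed.

(** A one-sided derivative of the integral, in the weak form that suffices for the
    minimum principle: increments are compared along one point [s] only. *)
Lemma Rintegral_left_increment (R : realType) (f : R -> R) (a t e : R) :
  {within `[0, +oo[, continuous f} -> 0 <= a -> a < t -> 0 < e ->
  exists2 s, a <= s < t &
   `|(\int[lebesgue_measure]_(u in `[0, t]) f u
      - \int[lebesgue_measure]_(u in `[0, s]) f u) - f t * (t - s)|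
   <= e * (t - s).
Proof.
move=> cf a0 at_ e0; have t0 : 0 <= t by lra.
have [dl dl0 H] := within_itv0y_dist cf t0 e0.
(* close enough to t for f to be within e of f t between s and t *)
pose s := Num.max a (t - dl / 2).
have as_ : a <= s by rewrite /s le_max lexx.
have ds : t - dl / 2 <= s by rewrite /s le_max lexx orbT.
have st : s < t by rewrite /s gt_max at_/=; lra.
exists s; first by rewrite as_ st.
have intf c : 0 <= c -> lebesgue_measure.-integrable `[0, c] (EFin \o f).
  move=> c0; apply: continuous_compact_integrable; first exact: segment_compact.
  by apply: continuous_subspaceW cf; apply: subset_itvl; rewrite bnd_simp.
have mst : lebesgue_measure.-integrable `]s, t] (EFin \o f).
  apply: integrableS (intf t t0) => //.
  by apply: subset_itvr; rewrite bnd_simp; lra.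
have cint c : lebesgue_measure.-integrable `]s, t] (EFin \o (fun _ : R => c)).
  have : lebesgue_measure.-integrable `[s, t] (EFin \o (fun _ : R => c)).
    apply: continuous_compact_integrable; first exact: segment_compact.
    by apply: continuous_subspaceT => x; exact: cst_continuous.
  apply: integrableS => //; exact: subset_itv_oc_cc.
have cE c : \int[lebesgue_measure]_(u in `]s, t]) c = c * (t - s).
  rewrite Rintegral_cst//= lebesgue_measure_itv/= lte_fin st.
  by [].
rewrite Rintegral_itvB ?bnd_simp//; [|exact: intf|lra|lra].
have near_t u : u \in `]s, t] -> `|f u - f t| < e.
  rewrite in_itv/= => /andP[su ut]; apply: H; first lra.
  by rewrite distrC ger0_norm; lra.
have up : \int[lebesgue_measure]_(u in `]s, t]) f u <= (f t + e) * (t - s).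
  rewrite -cE; apply: le_Rintegral => // u /near_t.
  by rewrite ltr_norml; lra.
have lo : (f t - e) * (t - s) <= \int[lebesgue_measure]_(u in `]s, t]) f u.
  rewrite -cE; apply: le_Rintegral => // u /near_t.
  by rewrite ltr_norml; lra.
by move: up lo; move: (Rintegral _ _ _) => I up lo; rewrite ler_norml; apply/andP; split; lra.
Qed.

(** * A discrete heat equation with additive noise *)

Definition lap (R : realType) (U : nat -> R -> R) (i : nat) (t : R) : R :=
  U i.+1 t + U i.-1 t - 2 * U i t.

(** [U] solves dU = lap U dt + dN on the sites 0 < i < d with zero boundary values.
    The equation is recorded through left difference quotients of [U - N], which
    keeps integrals out of the comparison argument and is stable under negation.
    The noise vanishes at the boundary sites so that interior and boundary
    neighbours can be treated alike. *)
Definition noisy_heat_flow (R : realType) (d : nat) (U N : nat -> R -> R) :=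
  [/\ forall i, (i <= d)%N -> {within `[0, +oo[, continuous U i},
      forall i, (i <= d)%N -> {within `[0, +oo[, continuous N i},
      forall t, 0 <= t -> [/\ U 0 t = 0, U d t = 0, N 0 t = 0 & N d t = 0] &
      forall i a t e, (0 < i < d)%N -> 0 <= a -> a < t -> 0 < e ->
        exists2 s, a <= s < t &
          `|(U i t - N i t) - (U i s - N i s) - lap U i t * (t - s)|
          <= e * (t - s)].

Lemma noisy_heat_flowN (R : realType) (d : nat) (U N : nat -> R -> R) :
  noisy_heat_flow d U N ->
  noisy_heat_flow d (fun i t => - U i t) (fun i t => - N i t).
Proof.
have cN (f : R -> R) : {within `[0, +oo[, continuous f} ->
    {within `[0, +oo[, continuous (fun t => - f t)}.
  move=> /subspace_continuousP cf; apply/subspace_continuousP => x Ax.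
  by apply: (@cvgN _ R^o); exact: cf.
case=> cU cV bd rate; split.
- by move=> i /cU /cN.
- by move=> i /cV /cN.
- by move=> t /bd [-> -> -> ->]; rewrite oppr0.
- move=> i a t e id a0 at_ e0; have [s st H] := rate i a t e id a0 at_ e0.
  exists s => //; rewrite -normrN; congr (`|_| <= _): H; rewrite /lap; ring.
Qed.

Definition parabola (R : realType) (d i : nat) : R := i%:R * (d%:R - i%:R).

Lemma parabola_ge0 (R : realType) d i : (i <= d)%N -> 0 <= parabola R d i.
Proof. by move=> id; rewrite mulr_ge0// subr_ge0 ler_nat. Qed.

Lemma parabola_le (R : realType) d i :
  (i <= d)%N -> parabola R d i <= d%:R ^+ 2.
Proof.
move=> id; rewrite /parabola.
have : i%:R <= d%:R :> R by rewrite ler_nat.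
have : 0 <= i%:R :> R by [].
nra.
Qed.

Lemma parabola_ge1 (R : realType) d i :
  (0 < i < d)%N -> 1 <= parabola R d i.
Proof.
move=> /andP[i0 id]; rewrite /parabola.
have : (i%:R + 1) <= d%:R :> R by rewrite natr1 ler_nat.
have : 1 <= i%:R :> R by rewrite ler1n.
nra.
Qed.

(** This is why the parabola is a barrier: the heat flow pulls it down at the
    same rate at every site. *)
Lemma parabola_lap (R : realType) d i : (0 < i)%N ->
  parabola R d i.+1 + parabola R d i.-1 - 2 * parabola R d i = - 2.
Proof. by case: i => // i _; rewrite /parabola /= -!natr1; ring. Qed.

Lemma min_over_family (R : realType) (d : nat) (D : nat -> R -> R) (s0 s1 : R) :
  s0 <= s1 ->
  (forall i, (i <= d)%N -> {within `[s0, s1], continuous D i}) ->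
  exists i t, [/\ (i <= d)%N, s0 <= t <= s1 &
    forall j s, (j <= d)%N -> s0 <= s <= s1 -> D i t <= D j s].
Proof.
move=> s01 cD.
have /choice[c cP] (i : 'I_d.+1) : exists c, s0 <= c <= s1 /\
    forall s, s0 <= s <= s1 -> D i c <= D i s.
  have [c cI cm] := EVT_min s01 (cD i (ltn_ord i)).
  by rewrite in_itv/= in cI; exists c; split.
have [i _ im] := @arg_minP _ _ _ (ord0 : 'I_d.+1) xpredT
  (fun i => D i (c i)) isT.
exists i, (c i); split; [exact: (ltn_ord i)|by case: (cP i)|] => j s jd sI.
pose jo : 'I_d.+1 := @Ordinal d.+1 j jd.
by apply: le_trans (im jo isT) _; case: (cP jo) => _; exact.
Qed.

(** The minimum principle for the difference [D] between the barrier and the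
    denoised path [U i s - (N i s - N i s0)].  Where [D] attains a negative minimum,
    the site is interior, the time is positive, and lap D >= 0; hence the
    Laplacian of [U] lies below the slope of the barrier there, and going slightly
    back in time [D] would be smaller. *)
Lemma comparison (R : realType) (d : nat) (U N : nat -> R -> R)
    (s0 a b n : R) :
  noisy_heat_flow d U N -> 0 <= s0 ->
  (forall i s, (i <= d)%N -> s0 <= s <= s0 + 1 -> `|N i s - N i s0| <= n) ->
  (forall i, (i <= d)%N -> U i s0 <= parabola R d i * a) ->
  0 <= b -> b * d%:R ^+ 2 + 4 * n < 2 * (a - b) ->
  forall i s, (i <= d)%N -> s0 <= s <= s0 + 1 ->
    U i s <= parabola R d i * (a - b * (s - s0)) + (N i s - N i s0).
Proof.
move=> [cU cN bd rate] s00 osc init b0 small.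
pose D i s := (parabola R d i * (a - b * (s - s0)) - N i s0) - (U i s - N i s).
have cD i : (i <= d)%N -> {within `[s0, s0 + 1], continuous D i}.
  move=> id; suff : {within `[0, +oo[, continuous D i}.
    by apply: continuous_subspaceW; apply: subset_itv; rewrite bnd_simp.
  apply: within_continuousB; last by apply: within_continuousB; [exact: cU|exact: cN].
  apply: continuous_subspaceT => x.
  apply: (@cvgB _ R^o); last exact: cvg_cst.
  apply: cvgM; first exact: cvg_cst.
  apply: (@cvgB _ R^o); first exact: cvg_cst.
  apply: cvgM; first exact: cvg_cst.
  by apply: (@cvgB _ R^o); [exact: cvg_id|exact: cvg_cst].
have [|i [t [id /andP[ts0 ts1] Dmin]]] := min_over_family _ cD; first by lra.
suff Dge0 : 0 <= D i t.
  move=> j s jd sI; have := le_trans Dge0 (Dmin j s jd sI).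
  by rewrite /D; lra.
rewrite leNgt; apply/negP => Dneg.
have t0 : 0 <= t by lra.
have Dbd j : j = 0%N \/ j = d -> D j t = 0.
  have [U0 Ud N0 Nd] := bd t t0.
  have [_ _ N00 N0d] := bd s0 s00.
  by case=> ->; rewrite /D /parabola ?U0 ?Ud ?N0 ?Nd ?N00 ?N0d; ring.
have iI : (0 < i < d)%N.
  have i0 : i <> 0%N by move=> iE; move: Dneg; rewrite Dbd ?ltxx//; left.
  have i1 : i <> d by move=> iE; move: Dneg; rewrite Dbd ?ltxx//; right.
  by rewrite lt0n ltn_neqAle id andbT; apply/andP; split; apply/eqP.
have lt_t : s0 < t.
  rewrite lt_neqAle ts0 andbT; apply/eqP => ts.
  by move: Dneg; rewrite /D -ts; have := init i id; lra.
have /andP[i0 i1] := iI.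
have lapU : lap U i t < - (b * parabola R d i).
  have tI : s0 <= t <= s0 + 1 by rewrite ts0.
  have := Dmin i.+1 t i1 tI; have := Dmin i.-1 t (leq_trans (leq_pred _) id) tI.
  have := osc i.+1 t i1 tI; have := osc i.-1 t (leq_trans (leq_pred _) id) tI.
  have := osc i t id tI; rewrite !ler_norml.
  have := parabola_lap R d i0.
  have := parabola_le R id; have := parabola_ge0 R id.
  rewrite /lap /D.
  set p := parabola R d i; set p1 := parabola R d i.+1.
  set p2 := parabola R d i.-1 => p0 pd pE o1 o2 o3.
  set q := a - b * (t - s0).
  have qb : a - b <= q by rewrite /q; nra.
  have -> : p1 = 2 * p - 2 - p2 by lra.
  rewrite mulrBl mulrBl.
  nra.
(* Half of the margin g is given up to the approximation error in [rate]. *)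
pose g := - (b * parabola R d i) - lap U i t.
have g0 : 0 < g / 2 by rewrite divr_gt0// /g; lra.
have [s /andP[sa st] ] := rate i s0 t (g / 2) iI s00 lt_t g0.
rewrite ler_norml => /andP[_ up].
have sI : s0 <= s <= s0 + 1 by apply/andP; split; lra.
have := Dmin i s id sI; rewrite /D.
have : 0 < g / 2 * (t - s) by rewrite mulr_gt0// subr_gt0.
move: up; rewrite /g; lra.
Qed.

(** The barrier is taken with the slope [a / d^2], for which the hypothesis on the
    noise makes [comparison] applicable.  After one unit of time the barrier has lost
    the fraction 1 / d^2 of its height, and adding the noise back costs a quarter
    of this loss. *)
Lemma barrier_step (R : realType) (d : nat) (U N : nat -> R -> R) (s0 a : R) :
  noisy_heat_flow d U N -> 0 <= s0 -> 0 < a ->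
  (forall i s, (i <= d)%N -> s0 <= s <= s0 + 1 ->
     `|N i s - N i s0| <= a / (4 * d%:R ^+ 2)) ->
  (forall i, (i <= d)%N -> U i s0 <= parabola R d i * a) ->
  [/\ forall i s, (i <= d)%N -> s0 <= s <= s0 + 1 ->
        U i s <= 2 * d%:R ^+ 2 * a &
      forall i, (i <= d)%N ->
        U i (s0 + 1) <= parabola R d i * (a * (1 - 3 / (4 * d%:R ^+ 2)))].
Proof.
move=> flow s00 a0 osc init.
have [_ _ bd _] := flow.
have [d1|d2] := leqP d 1.
  have U0 i s : (i <= d)%N -> 0 <= s -> U i s = 0.
    move=> id s_0; have [? ? _ _] := bd s s_0.
    by case: i id => [//|i id]; have -> : i.+1 = d by case: (d) d1 id => [|[|//]]//; case: (i).
  split=> [i s id /andP[ss _]|i id]; rewrite U0//; try lra.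
    by rewrite mulr_ge0 ?mulr_ge0 ?exprn_ge0// ltW.
  have -> : parabola R d i = 0.
    have [] : i = 0%N \/ i = d.
      by case: (d) (i) d1 id => [|[|//]] [|[|//]] //; [left|left|right].
    by move=> ->; rewrite /parabola mul0r.
    by move=> ->; rewrite /parabola subrr mulr0.
  by rewrite mul0r.
have D2 : 2 <= d%:R :> R by rewrite ler_nat.
set k : R := (d%:R ^+ 2)^-1.
have D0 : d%:R ^+ 2 != 0 :> R by rewrite expf_neq0// gt_eqF//; lra.
have kd : k * d%:R ^+ 2 = 1 by rewrite mulVf.
have k0 : 0 < k by rewrite invr_gt0 exprn_gt0//; lra.
have D4 : 4 <= d%:R ^+ 2 :> R by nra.
have k4 : k <= 1 / 4 by have := ler_wpM2l (ltW k0) D4; rewrite kd; lra.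
have nE : a / (4 * d%:R ^+ 2) = a * k / 4 by rewrite invfM -/k; lra.
have eE : 3 / (4 * d%:R ^+ 2) = 3 / 4 * k by rewrite invfM -/k; lra.
rewrite nE in osc; rewrite eE => {nE eE}.
have ak0 : 0 < a * k by rewrite mulr_gt0.
have cmp := @comparison R d U N s0 a (a * k) (a * k / 4) flow s00 osc init
  (ltW ak0).
have {}cmp := cmp (ltac:(rewrite -mulrA kd; nra)).
split=> [i s id sI|i id].
  have := cmp i s id sI; have := osc i s id sI.
  rewrite ler_norml => /andP[_ o].
  have := parabola_ge0 R id; have := parabola_le R id.
  case/andP: sI => s1 s2.
  set p := parabola R d i => pd p0.
  have : p * (a - a * k * (s - s0)) <= d%:R ^+ 2 * a.
    by apply: ler_pM => //; nra.
  have : a <= d%:R ^+ 2 * a by rewrite ler_peMl ?ltW//; nra.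
  nra.
have sI : s0 <= s0 + 1 <= s0 + 1 by apply/andP; split; lra.
have [/andP[i0 i1]|] := boolP (0 < i < d)%N.
  have iI : (0 < i < d)%N by rewrite i0.
  have := cmp i _ id sI; have := osc i _ id sI.
  rewrite ler_norml => /andP[_ o].
  have := parabola_ge1 R iI.
  set p := parabola R d i => p1.
  have : a * k / 4 <= p * (a * k / 4) by rewrite ler_peMl//; lra.
  lra.
rewrite negb_and -!leqNgt leqn0 => iE.
have s1 : 0 <= s0 + 1 by lra.
have [U0 Ud _ _] := bd _ s1.
case/orP: iE => [/eqP -> | di].
  by rewrite U0 /parabola !mul0r.
have -> : i = d by apply/eqP; rewrite eqn_leq id.
by rewrite Ud /parabola subrr mulr0 mul0r.
Qed.

(** The height of the barrier at the integer time [j], in units of a small multiple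
    of [eps].  The offset is so large that the relative loss in [barrier_step]
    exceeds the decrease by 1 from one integer time to the next. *)
Definition level (R : realType) (d J j : nat) : R :=
  2 * d%:R ^+ 2 + (J - j)%:R.

(** The bound holds between integer times because it holds, with the sharper factor
    [parabola R d i], at integer times; the latter is the invariant of the iteration
    of [barrier_step]. *)
Lemma flow_upper (R : realType) (d J : nat) (U N : nat -> R -> R) (theta : R) :
  (0 < d)%N -> noisy_heat_flow d U N -> 0 < theta ->
  (forall i j s, (i <= d)%N -> (j <= J)%N -> j%:R <= s <= j%:R + 1 ->
     `|N i s - N i j%:R| <= theta * level R d J j / (4 * d%:R ^+ 2)) ->
  (forall i, (i <= d)%N -> U i 0 <= parabola R d i * (theta * level R d J 0)) ->
  forall i j s, (i <= d)%N -> (j <= J)%N -> j%:R <= s <= j%:R + 1 ->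
    U i s <= 2 * d%:R ^+ 2 * (theta * level R d J j).
Proof.
move=> d0 flow th0 osc init.
have d1 : 1 <= d%:R :> R by rewrite ler1n.
have lv j : 2 * d%:R ^+ 2 <= level R d J j by rewrite /level lerDl.
have lv0 j : 0 < theta * level R d J j.
  by rewrite mulr_gt0// (lt_le_trans _ (lv j))// mulr_gt0// exprn_gt0//; lra.
have step j (jJ : (j <= J)%N) start :=
  @barrier_step R d U N j%:R _ flow (ler0n _ _) (lv0 j)
    (fun i s id sI => osc i j s id jJ sI) start.
suff start j : (j <= J)%N -> forall i, (i <= d)%N ->
    U i j%:R <= parabola R d i * (theta * level R d J j).
  move=> i j s id jJ sI.
  by have [+ _] := step j jJ (start j jJ); apply.
elim: j => [_|j IH jJ i id]; first exact: init.
have [_ /(_ i id)] := step j (ltnW jJ) (IH (ltnW jJ)).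
rewrite natr1 => /le_trans; apply.
rewrite ler_wpM2l ?parabola_ge0//.
have lE : level R d J j = level R d J j.+1 + 1.
  by rewrite /level -addrA natr1 subnSK.
have := lv0 j; have := lv j.+1; rewrite lE.
set l := level R d J j.+1 => ll l0.
set k : R := (d%:R ^+ 2)^-1.
have kd : d%:R ^+ 2 * k = 1 by rewrite mulfV// expf_neq0// gt_eqF//; lra.
have k0 : 0 < k by rewrite invr_gt0 exprn_gt0//; lra.
rewrite invfM -/k.
have : 2 <= l * k by have := ler_wpM2r (ltW k0) ll; rewrite -mulrA kd; lra.
nra.
Qed.

Lemma flow_bound (R : realType) (d J : nat) (U N : nat -> R -> R) (theta : R) :
  (0 < d)%N -> noisy_heat_flow d U N -> 0 < theta ->
  (forall i j s, (i <= d)%N -> (j <= J)%N -> j%:R <= s <= j%:R + 1 ->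
     `|N i s - N i j%:R| <= theta * level R d J j / (4 * d%:R ^+ 2)) ->
  (forall i, (i <= d)%N ->
     `|U i 0| <= parabola R d i * (theta * level R d J 0)) ->
  forall i j s, (i <= d)%N -> (j <= J)%N -> j%:R <= s <= j%:R + 1 ->
    `|U i s| <= 2 * d%:R ^+ 2 * (theta * level R d J j).
Proof.
move=> d0 flow th0 osc init i j s id jJ sI; rewrite ler_norml.
apply/andP; split.
  rewrite lerNl; apply: (flow_upper d0 (noisy_heat_flowN flow) th0 _ _ id jJ sI).
    by move=> i' j' s' ? ? ?; rewrite -opprD normrN; exact: osc.
  by move=> i' /init; rewrite ler_norml lerNl => /andP[].
apply: (flow_upper d0 flow th0 osc _ id jJ sI) => i' /init.
by rewrite ler_norml => /andP[].
Qed.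

(** * Deviation of the particles from the quasi-static profile *)

(** The solution c of c_(i+1) + c_(i-1) - 2 c_i = i / d with c_0 = c_d = 0: the lag
    of the particles behind the linear interpolation of the end points. *)
Definition profile_shift (R : realType) (d i : nat) : R :=
  (i%:R ^+ 3 - d%:R ^+ 2 * i%:R) / (6 * d%:R).

Definition quasi_static (R : realType) (d : nat) (eps : R) (i : nat) (t : R) : R :=
  i%:R + eps * (i%:R * t / d%:R + profile_shift R d i).

Record particle_path (R : realType) (d : nat) (sigma eps : R)
    (x W : nat -> R -> R) : Prop := ParticlePath {
  path_cont : forall i, (i <= d)%N -> {within `[0, +oo[, continuous x i};
  noise_cont : forall i, (0 < i < d)%N -> {within `[0, +oo[, continuous W i};
  path_init : forall i, (i <= d)%N -> x i 0 = i%:R;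
  path_left : forall t, 0 <= t -> x 0%N t = 0;
  path_right : forall t, 0 <= t -> x d t = d%:R + eps * t;
  path_eq : forall i t, (0 < i < d)%N -> 0 <= t ->
    x i t = x i 0 + \int[lebesgue_measure]_(s in `[0, t])
                      (x i.+1 s + x i.-1 s - 2 * x i s) + sigma * W i t }.

Lemma within_cst (R : realType) (A : set R) (c : R) :
  {within A, continuous (fun _ : R => c)}.
Proof. by apply: continuous_subspaceT => x; exact: cst_continuous. Qed.

Lemma within_scale (R : realType) (A : set R) (c : R) (f : R -> R) :
  {within A, continuous f} -> {within A, continuous (fun t => c * f t)}.
Proof.
move=> /subspace_continuousP cf; apply/subspace_continuousP => x Ax.
by apply: cvgM; [exact: cvg_cst | exact: cf].
Qed.

Lemma particle_path_flow (R : realType) (d : nat) (sigma eps : R)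
    (x W : nat -> R -> R) : (0 < d)%N ->
  particle_path d sigma eps x W ->
  noisy_heat_flow d (fun i t => x i t - quasi_static d eps i t)
    (fun i t => if (0 < i < d)%N then sigma * W i t else 0).
Proof.
move=> d0 [cx cW x0 xl xr xeq].
have dn0 : d%:R != 0 :> R by rewrite pnatr_eq0 -lt0n.
split.
- move=> i id; apply: within_continuousB; first exact: cx.
  apply: continuous_subspaceT => t.
  apply: (@cvgD _ R^o); first exact: cvg_cst.
  apply: cvgM; first exact: cvg_cst.
  apply: (@cvgD _ R^o); last exact: cvg_cst.
  apply: cvgM; last exact: cvg_cst.
  by apply: cvgM; [exact: cvg_cst|exact: cvg_id].
- move=> i id; case: (boolP (0 < i < d)%N) => [iI|_]; last exact: within_cst.
  by apply: within_scale; exact: cW.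
- move=> t t0; rewrite xl// xr// ltnn andbF /=.
  by split => //; rewrite /quasi_static /profile_shift; field.
- move=> i a t e iI a0 at_ e0; rewrite iI.
  have /andP[i0 id] := iI.
  pose f u := x i.+1 u + x i.-1 u - 2 * x i u.
  have cf : {within `[0, +oo[, continuous f}.
    apply: within_continuousB.
      apply: within_continuousD; first exact: cx.
      by apply: cx; exact: leq_trans (leq_pred _) (ltnW id).
    by apply: within_scale; apply: cx; exact: ltnW.
  have [s st H] := Rintegral_left_increment cf a0 at_ e0.
  exists s => //.
  have {}H : `|(x i t - sigma * W i t) - (x i s - sigma * W i s) - f t * (t - s)|
      <= e * (t - s).
    case/andP: st => sa st.
    have t0 : 0 <= t by lra.
    have s_0 : 0 <= s by lra.
    rewrite (xeq i t iI t0) (xeq i s iI s_0).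
    congr (`|_| <= _): H; rewrite -/f.
    move: (Rintegral _ _ _) (Rintegral _ _ _) => I1 I2; ring.
  congr (`|_| <= _): H.
  rewrite /lap /f /quasi_static /profile_shift.
  case: i i0 {id iI f cf} => // i _ /=; rewrite -!natr1.
  by field.
Qed.

Lemma profile_shift_le (R : realType) (d i : nat) : (0 < d)%N -> (i <= d)%N ->
  `|profile_shift R d i| <= parabola R d i / 3.
Proof.
move=> d0 id; have d1 : 0 < d%:R :> R by rewrite ltr0n.
have i0 : 0 <= i%:R :> R by [].
have id' : i%:R <= d%:R :> R by rewrite ler_nat.
have -> : profile_shift R d i = - (parabola R d i / 3 * ((d%:R + i%:R) / (2 * d%:R))).
  by rewrite /profile_shift /parabola; field; rewrite gt_eqF.
have p0 := parabola_ge0 R id.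
rewrite normrN ger0_norm.
  by rewrite ler_piMr ?divr_ge0// ler_pdivrMr; lra.
by rewrite mulr_ge0 ?divr_ge0//; lra.
Qed.

(** The hypothesis [d / eps <= J] makes the barrier at time 0, of height
    [eps * th * J] at least, dominate the initial deviation, which is of
    order [eps]. *)
Lemma path_deviation (R : realType) (d J : nat) (sigma eps th : R)
    (x W : nat -> R -> R) :
  (0 < d)%N -> particle_path d sigma eps x W -> 0 <= sigma -> 0 < eps ->
  eps <= th -> d%:R / eps <= J%:R ->
  (forall i j s, (0 < i < d)%N -> (j <= J)%N -> j%:R <= s <= j%:R + 1 ->
     sigma * `|W i s - W i j%:R| <= eps * th / (4 * d%:R ^+ 2) * (J - j).+1%:R) ->
  forall i t, (i <= d)%N -> 0 <= t -> t < J%:R + 1 ->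
    `|x i t - quasi_static d eps i t|
    <= 2 * d%:R ^+ 2 * (eps * th * (2 * d%:R ^+ 2 + (J%:R + 1 - t))).
Proof.
move=> d0 px s0 e0 eth dJ osc i t id t0 tJ.
have d1 : 1 <= d%:R :> R by rewrite ler1n.
have th0 : 0 < th by lra.
have eth0 : 0 < eps * th by rewrite mulr_gt0.
have D1 : 1 <= d%:R ^+ 2 :> R by nra.
have /andP[tr1 tr2] := truncn_itv t0.
set j := Num.truncn t in tr1 tr2.
have jJ : (j <= J)%N.
  by rewrite -ltnS -(ltr_nat R) -[J.+1%:R]natr1; lra.
have tI : j%:R <= t <= j%:R + 1 by rewrite tr1/= natr1 ltW.
have flow := particle_path_flow d0 px.
apply: le_trans (flow_bound d0 flow eth0 _ _ id jJ tI) _.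
- move=> i' j' s i'd j'J sI /=.
  case: (boolP (0 < i' < d)%N) => [iI|_]; last first.
    have lv0 : 0 <= level R d J j' by rewrite addr_ge0 ?mulr_ge0 ?exprn_ge0.
    by rewrite /= subrr normr0 divr_ge0 ?mulr_ge0 ?exprn_ge0 ?(ltW eth0) ?(ltW e0) ?(ltW th0).
  rewrite /= -mulrBr normrM (ger0_norm s0); apply: le_trans (osc _ _ _ iI j'J sI) _.
  rewrite mulrAC ler_wpM2r ?invr_ge0 ?mulr_ge0 ?exprn_ge0//.
  by rewrite ler_wpM2l ?(ltW eth0)// /level -natr1; lra.
- move=> i' i'd /=; rewrite (path_init px)// /quasi_static mulr0 mul0r add0r.
  rewrite opprD addNKr normrN normrM (gtr0_norm e0).
  have := profile_shift_le R d0 i'd; have := parabola_ge0 R i'd.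
  set p := parabola R d i'; set c := `|profile_shift R d i'| => p0 cp.
  have tJ1 : 1 <= th * J%:R.
    have := dJ; rewrite ler_pdivrMr// => dJ'.
    have : 0 <= J%:R :> R by [].
    nra.
  apply: le_trans (_ : eps * (p / 3) <= _); first by rewrite ler_wpM2l// ltW.
  rewrite /level subn0 [leRHS](_ : _ = eps * (p * (th * (2 * d%:R ^+ 2 + J%:R)))); last by ring.
  rewrite ler_pM2l// ler_wpM2l//.
  have : 0 <= th * (2 * d%:R ^+ 2) by rewrite mulr_ge0 ?mulr_ge0 ?exprn_ge0// ltW.
  lra.
rewrite ler_wpM2l ?mulr_ge0 ?exprn_ge0//.
rewrite ler_wpM2l ?(ltW eth0)// /level natrB//; lra.
Qed.

(** * Exit times of a path with small noise *)

Definition hitting_time (R : realType) (g : R -> R) : \bar R :=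
  ereal_inf [set t%:E | t in [set t : R | 0 <= t /\ g t = 2]].

Lemma hitting_time_ge (R : realType) (g : R -> R) (b : R) :
  (forall t, 0 <= t -> t < b -> g t != 2) -> (b%:E <= hitting_time g)%E.
Proof.
move=> H; apply: le_ereal_inf_tmp => _ [t [t0 gt] <-]; rewrite lee_fin leNgt.
by apply/negP => tb; move: (H t t0 tb); rewrite gt eqxx.
Qed.

Lemma hitting_time_lt (R : realType) (g : R -> R) (b : R) :
  {within `[0, +oo[, continuous g} -> 0 <= b -> g 0 <= 2 -> 2 < g b ->
  (hitting_time g < b%:E)%E.
Proof.
move=> cg b0 g0 gb.
have [c cI gc] : exists2 c, c \in `[0, b] & g c = 2.
  apply: IVT => //.
    by apply: continuous_subspaceW cg; apply: subset_itvl; rewrite bnd_simp.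
  by rewrite ge_min g0/= le_max (ltW gb) orbT.
move: cI; rewrite in_itv/= => /andP[c0 cb].
apply: le_lt_trans (_ : c%:E < _)%E.
  by apply: ereal_inf_lbound; exists c.
rewrite lte_fin lt_neqAle cb andbT; apply/eqP => cE.
by move: gb; rewrite -cE gc ltxx.
Qed.

(** The amount of time by which the i-th gap of the quasi-static profile reaches 2
    before [d / eps]; it equals d (c_i - c_(i-1)) for the shifts c of
    [profile_shift]. *)
Definition gap_delay (R : realType) (d i : nat) : R :=
  (3 * i%:R ^+ 2 - 3 * i%:R + 1 - d%:R ^+ 2) / 6.

Lemma gap_delay_last (R : realType) (d : nat) :
  gap_delay R d d = (d%:R - 1) * (2 * d%:R - 1) / 6.
Proof. rewrite /gap_delay; lra. Qed.

(** The last quasi-static gap reaches 2 a full time unit before the others, so that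
    errors of at most half a time unit cannot change the order. *)
Lemma gap_delay_lt (R : realType) (d i : nat) : (0 < i < d)%N ->
  gap_delay R d i <= gap_delay R d d - 1.
Proof.
move=> /andP[i0 id]; rewrite /gap_delay.
have : (i%:R + 1) <= d%:R :> R by rewrite natr1 ler_nat.
have : 1 <= i%:R :> R by rewrite ler1n.
nra.
Qed.

Lemma gapE (R : realType) (d : nat) (eps : R) (x : nat -> R -> R) i t :
  (0 < d)%N -> (0 < i)%N -> 0 < eps ->
  x i t - x i.-1 t - 2 = eps / d%:R * (t - d%:R / eps + gap_delay R d i)
    + ((x i t - quasi_static d eps i t) - (x i.-1 t - quasi_static d eps i.-1 t)).
Proof.
move=> d0 i0 e0; rewrite /quasi_static /profile_shift /gap_delay.
case: i i0 => // i _ /=; rewrite -natr1.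
by field; rewrite !gt_eqF// ltr0n.
Qed.

(** After division by the speed [eps / d] of the gaps, the deviation of a gap from
    its quasi-static value is at most z (A + (d / eps - t)) with a small z.  As z < 1,
    this cannot compensate the linear growth of d / eps - t away from the exit
    time, and at the exit time it is less than [eta]. *)
Lemma path_exit (R : realType) (d : nat) (sigma eps th eta : R)
    (x W : nat -> R -> R) :
  let J := (Num.truncn (d%:R / eps)).+1 in
  let c := d%:R / eps - gap_delay R d d in
  let tau i := hitting_time (fun t => x i t - x i.-1 t) in
  (0 < d)%N -> particle_path d sigma eps x W -> 0 <= sigma -> 0 < eps ->
  eps <= th -> 0 < eta <= 1 / 2 -> 0 <= c ->
  4 * d%:R ^+ 3 * th * (2 * d%:R ^+ 2 + 3 + gap_delay R d d) < eta ->
  (forall i j s, (0 < i < d)%N -> (j <= J)%N -> j%:R <= s <= j%:R + 1 ->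
     sigma * `|W i s - W i j%:R| <= eps * th / (4 * d%:R ^+ 2) * (J - j).+1%:R) ->
  [/\ ((c - eta)%:E <= tau d)%E, (tau d < (c + eta)%:E)%E &
      forall i, (0 < i < d)%N -> ((c + eta)%:E <= tau i)%E].
Proof.
move=> J c tau d0 px s0 e0 eth /andP[eta0 eta1] c0 zsmall osc.
have d1 : 1 <= d%:R :> R by rewrite ler1n.
set K := gap_delay R d d in zsmall.
have K0 : 0 <= K.
  by rewrite /K gap_delay_last divr_ge0// mulr_ge0//; lra.
set ts := d%:R / eps.
have ts0 : 0 <= ts by rewrite divr_ge0// ltW.
have /andP[tr1 tr2] := truncn_itv ts0.
have JE : J%:R = (Num.truncn ts)%:R + 1 :> R by rewrite natr1.
have tsJ : ts <= J%:R by rewrite ltW.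
have Jts : J%:R <= ts + 1 by rewrite JE; lra.
have dev := path_deviation d0 px s0 e0 eth tsJ osc.
pose z := 4 * d%:R ^+ 3 * th.
pose A := 2 * d%:R ^+ 2 + 2 : R.
have th0 : 0 < th by lra.
have z0 : 0 < z by rewrite /z mulr_gt0 ?mulr_gt0 ?exprn_gt0 //; lra.
have A0 : 2 <= A by rewrite /A; have := exprn_ge0 2 (ltW (lt_le_trans ltr01 d1)); lra.
have zs : z * (A + K + 1) < eta by apply: le_lt_trans zsmall; rewrite /z /A; lra.
have k0 : 0 < eps / d%:R by rewrite divr_gt0//; lra.
(* r is the deviation of the i-th gap divided by the speed eps / d. *)
have gap i t : (0 < i <= d)%N -> 0 <= t -> t <= ts + 1 / 2 ->
   exists2 r, `|r| <= z * (A + (ts - t)) &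
     x i t - x i.-1 t = 2 + eps / d%:R * (t - ts + gap_delay R d i + r).
  move=> /andP[i0 id] t0 tt.
  have tJ : t < J%:R + 1 by lra.
  have d_i := dev i t id t0 tJ.
  have d_i1 := dev i.-1 t (leq_trans (leq_pred _) id) t0 tJ.
  have := @gapE R d eps x i t d0 i0 e0; rewrite -/ts.
  set q1 := x i t - quasi_static d eps i t in d_i *.
  set q2 := x i.-1 t - quasi_static d eps i.-1 t in d_i1 *.
  move=> gE; exists ((q1 - q2) / (eps / d%:R)).
    rewrite normrM normfV (gtr0_norm k0) ler_pdivrMr//.
    apply: le_trans (ler_normB _ _) _; apply: le_trans (lerD d_i d_i1) _.
    have -> : z * (A + (ts - t)) * (eps / d%:R) =
        4 * d%:R ^+ 2 * (eps * th) * (A + (ts - t)).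
      by rewrite /z; field; rewrite gt_eqF//; lra.
    rewrite -mulrDr -mulrDr.
    rewrite [leLHS](_ : _ = 4 * d%:R ^+ 2 * (eps * th) *
       (2 * d%:R ^+ 2 + (J%:R + 1 - t))); last by ring.
    rewrite ler_wpM2l ?mulr_ge0 ?exprn_ge0 ?(ltW e0) ?(ltW th0)//.
    by rewrite /A; lra.
  rewrite [in RHS]mulrDr [X in _ + (_ + X)]mulrC divfK ?gt_eqF//; lra.
have cg i : (0 < i <= d)%N ->
    {within `[0, +oo[, continuous (fun t => x i t - x i.-1 t)}.
  move=> /andP[i0 id]; apply: within_continuousB; apply: (path_cont px) => //.
  exact: leq_trans (leq_pred _) id.
have dI : (0 < d <= d)%N by rewrite d0 leqnn.
split.
- apply: hitting_time_ge => t t0 tc.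
  have tts : t <= ts + 1 / 2 by rewrite /c -/K -/ts in tc; lra.
  have [r rb ->] := gap d t dI t0 tts; rewrite -/K.
  rewrite lt_eqF// gtrDl pmulr_rlt0//.
  move: rb; rewrite ler_norml => /andP[_].
  rewrite /c -/K -/ts in tc.
  nra.
- have cc0 : 0 <= c + eta by lra.
  have ctt : c + eta <= ts + 1 / 2 by rewrite /c -/K -/ts; lra.
  apply: hitting_time_lt; [exact: cg|exact: cc0| |].
    have d1d : (d.-1 <= d)%N := leq_pred d.
    rewrite !(path_init px)//; case: (d) d0 => // n _ /=; rewrite -natr1; lra.
  have [r rb ->] := gap d _ dI cc0 ctt; rewrite -/K.
  rewrite ltrDl pmulr_rgt0//.
  move: rb; rewrite ler_norml => /andP[+ _].
  rewrite /c -/K -/ts.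
  nra.
- move=> i iI; have iI' : (0 < i <= d)%N by case/andP: iI => -> /ltnW.
  apply: hitting_time_ge => t t0 tc.
  have tts : t <= ts + 1 / 2 by rewrite /c -/K -/ts in tc; lra.
  have [r rb ->] := gap i t iI' t0 tts.
  rewrite lt_eqF// gtrDl pmulr_rlt0//.
  move: rb; rewrite ler_norml => /andP[_].
  have := gap_delay_lt R iI; rewrite -/K.
  rewrite /c -/K -/ts in tc.
  nra.
Qed.

(** * Gaussian tails *)

Lemma expRN_le_sqr (R : realType) (v : R) : 0 < v -> expR (- v) <= 4 / v ^+ 2.
Proof.
move=> v0; rewrite expRN -[4 / _]invrK lef_pV2 ?posrE ?expR_gt0 ?invr_gt0 ?divr_gt0 ?exprn_gt0//.
rewrite invf_div.
have -> : v = v / 2 + v / 2 by lra.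
rewrite expRD -[in leRHS]expr2.
have := expR_ge1Dx (v / 2) => H.
have -> : (v / 2 + v / 2) ^+ 2 / 4 = (v / 2) ^+ 2 by field.
by rewrite ler_pXn2r ?nnegrE ?expR_ge0//; lra.
Qed.

Lemma measurable_abs_gt (R : realType) (y : R) :
  measurable [set u : R | y < `|u|].
Proof.
rewrite (_ : [set u | _] = [set` `]-oo, - y[] `|` [set` `]y, +oo[]).
  exact: measurableU.
apply/seteqP; split => u /=; rewrite !in_itv/= andbT lter_normr.
  by move=> /orP[?|?]; [right|left; lra].
by move=> [?|?]; apply/orP; [right; lra|left].
Qed.

(** On [y < |u|], half of the exponent bounds the density by
    2 exp(- y^2 / (4 s)) times the density of variance [2 s], whose integral is 1.
    A fourth power is what the chaining argument uses. *)
Lemma normal_prob_tail (R : realType) (s y : R) : 0 < s -> 0 < y ->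
  (normal_prob 0%R (Num.sqrt s) [set u : R | (y < `|u|)%R]
   <= (128 * s ^+ 2 / y ^+ 4)%:E)%E.
Proof.
move=> s0 y0; rewrite /normal_prob.
have ss0 : Num.sqrt s != 0 by rewrite gt_eqF ?sqrtr_gt0.
have s20 : 0 < s * 2 by lra.
have ss20 : Num.sqrt (s * 2) != 0 by rewrite gt_eqF ?sqrtr_gt0.
pose c : R := 128 * s ^+ 2 / y ^+ 4.
have c0 : 0 <= c by rewrite /c divr_ge0 ?mulr_ge0 ?exprn_ge0 ?ltW.
have mV := measurable_abs_gt y.
have mpdf t : measurable_fun [set: R] (EFin \o @normal_pdf R 0 t).
  by apply/measurable_EFinP; exact: measurable_normal_pdf.
have dom u : y < `|u| ->
    normal_pdf 0 (Num.sqrt s) u <= c * normal_pdf 0 (Num.sqrt (s * 2)) u.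
  move=> yu; rewrite !normal_pdfE// /normal_fun subr0 /normal_peak !sqr_sqrtr ?(ltW s0) ?(ltW s20)//.
  have yu2 : y ^+ 2 <= u ^+ 2.
    by rewrite -[u ^+ 2]real_normK ?num_real// ler_pXn2r ?nnegrE ?ltW//; lra.
  have pk : (Num.sqrt (s * pi *+ 2))^-1 <= 2 * (Num.sqrt (s * 2 * pi *+ 2))^-1.
    have p0 : 0 < s * pi *+ 2 by rewrite mulrn_wgt0// mulr_gt0// pi_gt0.
    have p20 : 0 < s * 2 * pi *+ 2 by rewrite mulrn_wgt0// mulr_gt0// pi_gt0.
    rewrite -[2 * _]invrK lef_pV2 ?posrE ?invr_gt0 ?mulr_gt0 ?invr_gt0 ?sqrtr_gt0//.
    rewrite invfM invrK.
    have -> : s * 2 * pi *+ 2 = 2 * (s * pi *+ 2).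
      by rewrite !mulr2n; move: (pi : R) => p; ring.
    rewrite sqrtrM//.
    have : Num.sqrt 2 <= 2 :> R.
      by rewrite -[leRHS]ger0_norm// -sqrtr_sqr ler_sqrt; lra.
    have := sqrtr_ge0 (s * pi *+ 2); nra.
  have ex : expR (- u ^+ 2 / (s *+ 2))
      <= 64 * s ^+ 2 / y ^+ 4 * expR (- u ^+ 2 / (s * 2 *+ 2)).
    have -> : - u ^+ 2 / (s *+ 2) = - (u ^+ 2 / (4 * s)) + - u ^+ 2 / (s * 2 *+ 2).
      rewrite !mulr2n; field.
      by apply/and3P; split; rewrite gt_eqF//; lra.
    rewrite expRD ler_wpM2r ?expR_ge0//.
    apply: le_trans (_ : expR (- (y ^+ 2 / (4 * s))) <= _).
      by rewrite ler_expR lerN2 ler_wpM2r// invr_ge0; lra.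
    apply: le_trans (expRN_le_sqr _) _; first by rewrite divr_gt0 ?exprn_gt0//; lra.
    rewrite le_eqVlt; apply/orP; left; apply/eqP; field.
    by rewrite !gt_eqF.
  apply: le_trans (ler_pM _ _ pk ex) _; rewrite ?expR_ge0 ?invr_ge0 ?sqrtr_ge0//.
  by rewrite le_eqVlt; apply/orP; left; apply/eqP; rewrite /c; ring.
apply: (@le_trans _ _ (\int[lebesgue_measure]_(u in [set u : R | (y < `|u|)%R])
   (c%:E * (normal_pdf 0 (Num.sqrt (s * 2)) u)%:E))%E).
  apply: ge0_le_integral => //.
  - by move=> u _; rewrite lee_fin normal_pdf_ge0.
  - exact: measurable_funTS (mpdf _).
  - exact: (measurable_funTS (measurable_funeM c%:E (mpdf (Num.sqrt (s * 2))))).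
rewrite ge0_integralZl//; last 2 first.
  - exact: measurable_funTS (mpdf _).
  - by move=> u _; rewrite lee_fin normal_pdf_ge0.
rewrite -[leRHS]mule1 lee_pmul//.
  by apply: integral_ge0 => u _; rewrite lee_fin normal_pdf_ge0.
rewrite -(@integral_normal_pdf R 0 (Num.sqrt (s * 2))).
apply: ge0_subset_integral => //; first exact: mpdf.
by move=> u _; rewrite lee_fin normal_pdf_ge0.
Qed.

(** * Properties that hold up to a small failure probability *)

(** Probabilities of non-measurable sets are meaningless, hence the measurable set
    [N] that contains all failures. *)
Definition holds_but {R : realType} {disp : measure_display}
    {T : measurableType disp} (P : probability T R) (b : R) (Q : T -> Prop) :=
  exists N : set T, [/\ measurable N, (P N <= b%:E)%E & forall w, ~ N w -> Q w].

Section holds_but_theory.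
Context {R : realType} {disp : measure_display} {T : measurableType disp}.
Variable P : probability T R.
Implicit Types (b c : R) (Q : T -> Prop).

Lemma holds_but_ae Q : {ae P, forall w, Q w} -> holds_but P 0 Q.
Proof.
move=> [N [mN PN sub]]; exists N; split=> //; first by rewrite PN.
by move=> w Nw; apply: contrapT => Qw; apply: Nw; exact: sub.
Qed.

Lemma holds_but_impl b c Q Q' : b <= c -> (forall w, Q w -> Q' w) ->
  holds_but P b Q -> holds_but P c Q'.
Proof.
move=> bc QQ' [N [mN PN HN]]; exists N; split=> //.
  by apply: le_trans PN _; rewrite lee_fin.
by move=> w /HN /QQ'.
Qed.

Lemma holds_but_and b c Q Q' : holds_but P b Q -> holds_but P c Q' ->
  holds_but P (b + c) (fun w => Q w /\ Q' w).
Proof.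
move=> [N [mN PN HN]] [N' [mN' PN' HN']]; exists (N `|` N'); split.
- exact: measurableU.
- by rewrite EFinD; apply: le_trans (leeD PN PN'); exact: measureU2.
- by move=> w /not_orP[/HN ? /HN' ?].
Qed.

Lemma holds_but_forall (b : nat -> R) c (Q : nat -> T -> Prop) :
  (forall n, \sum_(k < n) b k <= c) -> (forall k, holds_but P (b k) (Q k)) ->
  holds_but P c (fun w => forall k, Q k w).
Proof.
move=> bc /choice[N HN]; exists (\bigcup_k N k); split.
- by apply: bigcupT_measurable => k; case: (HN k).
- apply: (@le_trans _ _ (\sum_(0 <= k <oo) P (N k))%E).
    apply: measure_sigma_subadditive => //; first by move=> k; case: (HN k).
    by apply: bigcupT_measurable => k; case: (HN k).
  apply: lime_le; first by apply: is_cvg_nneseries => *.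
  apply: nearW => n; rewrite big_mkord.
  apply: (@le_trans _ _ (\sum_(k < n) (b k)%:E)%E).
    by apply: lee_sum => k _; case: (HN k).
  by rewrite sumEFin lee_fin.
- move=> w Nw k; case: (HN k) => _ _; apply => Nk; apply: Nw.
  by exists k.
Qed.

Lemma holds_but_forall_lt n b (Q : nat -> T -> Prop) : 0 <= b ->
  (forall k, (k < n)%N -> holds_but P b (Q k)) ->
  holds_but P (n%:R * b) (fun w => forall k, (k < n)%N -> Q k w).
Proof.
move=> b0 HQ.
apply: (@holds_but_forall (fun k => if (k < n)%N then b else 0)).
  move=> m; suff -> : \sum_(k < m) (if (k < n)%N then b else 0) = (minn m n)%:R * b.
    by rewrite ler_wpM2r// ler_nat geq_minr.
  elim: m => [|m IH]; first by rewrite big_ord0 min0n mul0r.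
  rewrite big_ord_recr /= IH; case: (ltnP m n) => mn.
    by rewrite (minn_idPl mn) -natr1 mulrDl mul1r.
  by rewrite addr0 (minn_idPr (leqW mn)).
move=> k; case: ifPn => kn.
  by apply: holds_but_impl (HQ k kn).
by exists set0; split => //; rewrite ?measure0// => w _.
Qed.

Lemma holds_but_le (b : R) (Q : T -> Prop) (E : set T) : measurable E ->
  (forall w, Q w -> ~ E w) -> holds_but P b Q -> (P E <= b%:E)%E.
Proof.
move=> mE QE [N [mN PN HN]]; apply: le_trans PN.
apply: le_measure; rewrite ?inE// => w Ew; apply: contrapT => /HN /QE; exact.
Qed.

Lemma holds_but_ge (b : R) (Q : T -> Prop) (E : set T) : measurable E ->
  (forall w, Q w -> E w) -> holds_but P b Q -> ((1 - b)%:E <= P E)%E.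
Proof.
move=> mE QE hb.
have : (P (~` E) <= b%:E)%E.
  by apply: holds_but_le hb; [exact: measurableC|move=> w /QE Ew].
rewrite probability_setC// -(fineK (fin_num_measure P _ mE)) -EFinB !lee_fin.
lra.
Qed.

End holds_but_theory.

(** * Oscillations of Brownian motion *)

(** From a dyadic point of level [m + 1] one increment leads to a dyadic point of
    level [m]. *)
Lemma dyadic_chaining (R : realType) (f : R -> R) (a S : R) (delta : nat -> R) :
  {within `[0, +oo[, continuous f} -> 0 <= a ->
  (forall n, \sum_(m < n) delta m <= S) ->
  (forall m k, (k < 2 ^ m)%N ->
     `|f (a + k.+1%:R / 2 ^+ m) - f (a + k%:R / 2 ^+ m)| <= delta m) ->
  forall s, a <= s <= a + 1 -> `|f s - f a| <= S.
Proof.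
move=> cf a0 dS inc.
have grid m k : (k <= 2 ^ m)%N ->
    `|f (a + k%:R / 2 ^+ m) - f a| <= \sum_(l < m.+1) delta l.
  elim: m k => [|m IH] k.
    rewrite expn0 big_ord1; have := inc 0%N 0%N isT.
    rewrite mul0r addr0 => H; case: k => [_|[|//] _ //].
    by rewrite mul0r addr0 subrr normr0 (le_trans _ H).
  move=> kle.
  have half l : (l.*2)%:R / 2 ^+ m.+1 = l%:R / 2 ^+ m :> R.
    rewrite -muln2 natrM exprS invfM; field.
    by rewrite expf_neq0.
  have delta0 : 0 <= delta m.+1.
    by apply: le_trans (inc m.+1 0%N _); rewrite // expn_gt0.
  rewrite big_ord_recr /=.
  have kl : (k./2 <= 2 ^ m)%N by move: kle; rewrite expnS; lia.
  have /IH := kl; rewrite -half => kIH.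
  rewrite -[k in X in `|X|]odd_double_half.
  case: (boolP (odd k)) => ok; last first.
    by rewrite /= add0n; apply: le_trans kIH _; rewrite lerDl.
  rewrite /= add1n [leRHS]addrC.
  have k2 : (k./2.*2 < 2 ^ m.+1)%N by have := odd_double_half k; rewrite ok; lia.
  rewrite -[X in `|X|](subrKA (f (a + (k./2.*2)%:R / 2 ^+ m.+1))).
  by apply: le_trans (ler_normD _ _) _; apply: lerD => //; exact: inc.
move=> s /andP[as_ sa]; have s0 : 0 <= s by lra.
apply/ler_addgt0Pr => e e0.
have [dl dl0 near_s] := within_itv0y_dist cf s0 e0.
pose m := (Num.truncn dl^-1).+1.
have p0 : 0 < 2 ^+ m :> R by rewrite exprn_gt0.
have m_small : (2 ^+ m)^-1 < dl.
  rewrite -[dl]invrK ltf_pV2 ?posrE ?invr_gt0//.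
  have dl1 : 0 <= dl^-1 by rewrite invr_ge0 ltW.
  have /andP[_ t2] := truncn_itv dl1; apply: lt_le_trans t2 _.
  by rewrite -natrX ler_nat ltnW// ltn_expl.
have sm0 : 0 <= (s - a) * 2 ^+ m by rewrite mulr_ge0 ?(ltW p0)//; lra.
have /andP[t1 t2] := truncn_itv sm0.
set k := Num.truncn _ in t1 t2.
have kle : (k <= 2 ^ m)%N.
  rewrite -(ler_nat R) natrX; apply: le_trans t1 _.
  by rewrite ler_piMl ?(ltW p0)//; lra.
have r1 : k%:R / 2 ^+ m <= s - a by rewrite ler_pdivrMr.
have r2 : s - a < k%:R / 2 ^+ m + (2 ^+ m)^-1.
  by rewrite -(ltr_pM2r p0) [ltRHS]mulrDl divfK ?mulVf ?gt_eqF// natr1.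
have r0 : 0 <= k%:R / 2 ^+ m :> R by rewrite divr_ge0 ?(ltW p0).
have close : `|a + k%:R / 2 ^+ m - s| < dl.
  by rewrite ler0_norm; lra.
have := near_s _ _ close; rewrite distrC => /(_ ltac:(lra)) H.
rewrite -[f s - f a](subrKA (f (a + k%:R / 2 ^+ m))).
apply: le_trans (ler_normD _ _) _; rewrite addrC; apply: lerD; last exact: ltW.
exact: le_trans (grid m k kle) (dS _).
Qed.

Lemma geometric_sum_le (R : realFieldType) (r : R) n : 0 <= r -> r < 1 ->
  \sum_(m < n) r ^+ m <= (1 - r)^-1.
Proof.
move=> r0 r1; have h : 0 < 1 - r by lra.
have -> : \sum_(m < n) r ^+ m = (1 - r ^+ n) / (1 - r).
  apply: (canRL (mulfK (lt0r_neq0 h))).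
  elim: n => [|n IH]; first by rewrite big_ord0 mul0r expr0 subrr.
  by rewrite big_ord_recr /= mulrDl IH exprS; ring.
by rewrite ler_pdivrMr// mulVf ?lt0r_neq0// gerBl exprn_ge0.
Qed.

Lemma inv_square_sum_le (R : realFieldType) n :
  \sum_(k < n) (k.+1%:R ^- 2) <= 2 :> R.
Proof.
suff : \sum_(k < n.+1) (k.+1%:R ^- 2) <= 2 - n.+1%:R^-1 :> R.
  have : 0 <= n.+1%:R ^- 2 :> R by rewrite invr_ge0 exprn_ge0.
  have : 0 <= n.+1%:R^-1 :> R by rewrite invr_ge0.
  rewrite big_ord_recr /=; move: (\sum_(_ < _) _) => S.
  by move: (n.+1%:R ^- 2) (n.+1%:R^-1) => a b a0 b0 H; lra.
elim: n => [|n IH]; first by rewrite big_ord1 expr1n invr1; lra.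
rewrite big_ord_recr /=; apply: le_trans (lerD IH (lexx _)) _.
have n0 : 0 < n.+1%:R :> R by [].
rewrite -[n.+2%:R]natr1; set x : R := n.+1%:R in n0 *.
have : 0 <= x^-1 - (x + 1)^-1 - (x + 1) ^- 2.
  have -> : x^-1 - (x + 1)^-1 - (x + 1) ^- 2 = x^-1 * (x + 1) ^- 2.
    by field; rewrite !gt_eqF//; lra.
  by rewrite mulr_ge0 ?invr_ge0 ?exprn_ge0//; lra.
by move: (x^-1) ((x + 1)^-1) ((x + 1) ^- 2) => u v w H; lra.
Qed.

Lemma chaining_ratio_sum_le (R : realFieldType) n :
  \sum_(m < n) ((2 * (9 / 10) ^+ 4)^-1) ^+ m <= 5 :> R.
Proof.
have rE : 5 / 4 <= 2 * (9 / 10 : R) ^+ 4 by rewrite !exprS expr0; lra.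
move: (2 * (9 / 10) ^+ 4) rE => u rE.
have u0 : 0 < u by lra.
have u1 : u^-1 <= 4 / 5 by rewrite invf_ple ?posrE//; lra.
have uge : 0 <= u^-1 by rewrite invr_ge0 ltW.
move: (u^-1) u1 uge => q q1 q0; have q2 : q < 1 by lra.
apply: le_trans (geometric_sum_le n q0 q2) _.
by rewrite invf_ple ?posrE//; lra.
Qed.

Section brownian.
Context {R : realType} {disp : measure_display} {T : measurableType disp}.
Variable P : probability T R.

(** 128 from [normal_prob_tail], 10^4 from the factor 1 / 10 in the chaining thresholds,
    and 5 from [chaining_ratio_sum_le]. *)
Definition chaining_constant : R := 64 * 10 ^+ 5.

Lemma brownian_increment_tail (W : R -> {RV P >-> R}) (sigma s t y : R) :
  standard_brownian_motion W -> 0 <= sigma -> 0 <= s -> s < t -> 0 < y ->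
  holds_but P (128 * (t - s) ^+ 2 * (sigma / y) ^+ 4)
    (fun w => sigma * `|W t w - W s w| <= y).
Proof.
move=> [_ incr _ _] sigma0 s0 st y0.
have [->|sigman0] := eqVneq sigma 0.
  exists set0; split => // [|w _]; last by rewrite mul0r ltW.
  by rewrite measure0 lee_fin mul0r expr0n mulr0.
have sigma_gt0 : 0 < sigma by rewrite lt0r sigman0.
exists (increment W s t @^-1` [set u | y / sigma < `|u|]); split.
- rewrite -[X in measurable X]setTI.
  have mi : measurable_fun setT (increment W s t).
    by apply: measurable_funB; exact: measurable_funPT.
  by apply: mi => //; exact: measurable_abs_gt.
- rewrite incr//; last exact: measurable_abs_gt.
  apply: le_trans (normal_prob_tail _ _) _; rewrite ?subr_gt0 ?divr_gt0//.
  rewrite lee_fin le_eqVlt; apply/orP; left; apply/eqP; field.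
  by rewrite sigman0 gt_eqF.
- move=> w /= /negP; rewrite -leNgt /increment ler_pdivlMr// mulrC.
  by [].
Qed.

(** Chaining with the thresholds (y / 10) (9 / 10)^m, which sum to [y].  There are 2^m
    increments of variance 2^-m at level [m], so the failure probability at level
    [m] is a multiple of 2^m 4^-m (9 / 10)^(-4 m), which is summable because
    2 (9 / 10)^4 > 1. *)
Lemma brownian_oscillation (W : R -> {RV P >-> R}) (sigma a y : R) :
  standard_brownian_motion W -> 0 <= sigma -> 0 <= a -> 0 < y ->
  holds_but P (chaining_constant * (sigma / y) ^+ 4)
    (fun w => forall s, a <= s <= a + 1 -> sigma * `|W s w - W a w| <= y).
Proof.
move=> bm sigma0 a0 y0.
pose r : R := 9 / 10; pose q : R := (2 * r ^+ 4)^-1.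
pose delta m := y / 10 * r ^+ m.
have delta0 m : 0 < delta m by rewrite mulr_gt0 ?exprn_gt0// /r; lra.
pose beta m : R := 128 * 10 ^+ 4 * (sigma / y) ^+ 4 * q ^+ m.
have sy0 : 0 <= (sigma / y) ^+ 4 by rewrite exprn_ge0// divr_ge0// ltW.
have level m : holds_but P (beta m) (fun w => forall k, (k < 2 ^ m)%N ->
    sigma * `|W (a + k.+1%:R / 2 ^+ m) w - W (a + k%:R / 2 ^+ m) w| <= delta m).
  have p0 : 0 < 2 ^+ m :> R by rewrite exprn_gt0.
  have -> : beta m = (2 ^ m)%:R * (128 * ((2 ^+ m)^-1) ^+ 2 * (sigma / delta m) ^+ 4).
    rewrite natrX /beta /delta.
    have -> : q ^+ m = (2 ^+ m)^-1 * (r ^+ m) ^- 4.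
      by rewrite /q exprVn exprMn -exprM mulnC exprM invfM.
    by field; rewrite !gt_eqF//= exprn_gt0// /r; lra.
  apply: holds_but_forall_lt.
    by rewrite !mulr_ge0 ?exprn_ge0 ?divr_ge0 ?invr_ge0 ?(ltW p0) ?(ltW (delta0 m)).
  move=> k km.
  have := @brownian_increment_tail W sigma (a + k%:R / 2 ^+ m)
    (a + k.+1%:R / 2 ^+ m) (delta m) bm sigma0.
  have -> : a + k.+1%:R / 2 ^+ m - (a + k%:R / 2 ^+ m) = (2 ^+ m)^-1.
    by rewrite -natr1; field; rewrite gt_eqF.
  apply => //; first by rewrite addr_ge0// divr_ge0// ltW.
  by rewrite ltrD2l ltr_pM2r ?invr_gt0// ltr_nat.
have [_ _ _ /holds_but_ae cW] := bm.
have levels : holds_but P (chaining_constant * (sigma / y) ^+ 4) (fun w =>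
    forall m k, (k < 2 ^ m)%N ->
    sigma * `|W (a + k.+1%:R / 2 ^+ m) w - W (a + k%:R / 2 ^+ m) w| <= delta m).
  apply: (holds_but_forall _ level) => n.
  rewrite -big_distrr /= /chaining_constant.
  have qn : \sum_(m < n) q ^+ m <= 5 by exact: chaining_ratio_sum_le.
  rewrite [leRHS](_ : _ = 128 * 10 ^+ 4 * (sigma / y) ^+ 4 * 5).
    by rewrite ler_wpM2l// mulr_ge0// mulr_ge0// exprn_ge0.
  rewrite /chaining_constant; move: ((sigma / y) ^+ 4) => u; ring.
apply: holds_but_impl (holds_but_and cW levels); first by rewrite add0r.
move=> w [cw lw] s sI.
have -> : sigma * `|W s w - W a w| = `|sigma * W s w - sigma * W a w|.
  by rewrite -mulrBr normrM ger0_norm.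
apply: (@dyadic_chaining R (fun t => sigma * W t w) a y delta) => //.
- move/subspace_continuousP: cw => cw; apply/subspace_continuousP => x Ax.
  by apply: cvgM; [exact: cvg_cst | exact: cw].
- move=> n; rewrite -big_distrr /=.
  have := @geometric_sum_le R r n; rewrite /r => /(_ ltac:(lra) ltac:(lra)).
  have -> : (1 - 9 / 10 : R)^-1 = 10 by field.
  nra.
- by move=> m k km; rewrite -mulrBr normrM ger0_norm// lw.
Qed.

(** The bound does not depend on the length [J] of the time horizon, because the
    allowed oscillation grows with the distance to the horizon and the
    failure probabilities are summable in this distance. *)
Lemma noise_small (d J : nat) (B : nat -> R -> {RV P >-> R}) (sigma y : R) :
  independent_brownian_motions 1 d B -> 0 <= sigma -> 0 < y ->
  holds_but P (d%:R * (2 * chaining_constant * (sigma / y) ^+ 4))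
    (fun w => forall i j s, (0 < i < d)%N -> (j <= J)%N ->
       j%:R <= s <= j%:R + 1 ->
       sigma * `|B i s w - B i j%:R w| <= y * (J - j).+1%:R).
Proof.
move=> [bm _] sigma0 y0.
have C0 : 0 <= chaining_constant by rewrite /chaining_constant mulr_ge0// exprn_ge0.
have sy0 : 0 <= (sigma / y) ^+ 4 by rewrite exprn_ge0// divr_ge0// ltW.
have one i : (i < d)%N -> holds_but P (2 * chaining_constant * (sigma / y) ^+ 4)
    (fun w => (0 < i)%N -> forall k s, (J - k)%:R <= s <= (J - k)%:R + 1 ->
       sigma * `|B i s w - B i (J - k)%:R w| <= y * k.+1%:R).
  move=> id; have [->|i0] := posnP i.
    exists set0; split => //; rewrite measure0 lee_fin.
    by rewrite mulr_ge0// mulr_ge0.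
  have bmi : standard_brownian_motion (B i) by apply: bm; rewrite i0.
  apply: holds_but_impl (lexx _) (fun _ H _ => H) _.
  apply: (@holds_but_forall _ _ _ _
    (fun k => chaining_constant * (sigma / y) ^+ 4 * k.+1%:R ^- 2)).
    move=> n; rewrite -big_distrr /=.
    have := @inv_square_sum_le R n; have := mulr_ge0 C0 sy0; nra.
  move=> k.
  have yk : 0 < y * k.+1%:R by rewrite mulr_gt0.
  apply: holds_but_impl (brownian_oscillation bmi sigma0 (ler0n _ (J - k)) yk) => //.
  rewrite -mulrA ler_wpM2l// invfM mulrA exprMn ler_wpM2l// -exprVn.
  have x0 : 0 <= k.+1%:R^-1 :> R by rewrite invr_ge0.
  have x1 : k.+1%:R^-1 <= 1 :> R by rewrite invf_le1// ler1n.
  by rewrite ler_wiXn2l.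
apply: holds_but_impl (lexx _) _ (holds_but_forall_lt _ one).
  move=> w H i j s /andP[i0 id] jJ sI.
  by have := H i id i0 (J - j)%N s; rewrite subKn//; apply.
by rewrite mulr_ge0// mulr_ge0.
Qed.

End brownian.

(** * Measurability of exit times *)

Lemma exists_inv_natS_lt (R : realType) (y : R) : 0 < y ->
  exists n : nat, n.+1%:R^-1 < y.
Proof.
move=> y0; have y1 : 0 <= y^-1 by rewrite invr_ge0 ltW.
exists (Num.truncn y^-1); have /andP[_ H] := truncn_itv y1.
by rewrite -[ltRHS]invrK ltf_pV2 ?posrE ?invr_gt0.
Qed.

(** Hitting a level in a compact interval is a countable condition on a continuous
    path: a positive minimum of [|g - 2|] would be detected.  Rational multiples of [b]
    are used, so that [b = 0] needs no separate treatment. *)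
Lemma reaches_rationally (R : realType) (g : R -> R) (b : R) :
  {within `[0, +oo[, continuous g} -> 0 <= b ->
  (exists2 s, 0 <= s <= b & g s = 2) <->
  (forall n : nat, exists2 q : rat, 0 <= (ratr q : R) <= 1 &
     `|g (b * ratr q) - 2| < n.+1%:R^-1).
Proof.
move=> cg b0; split.
  move=> [s /andP[s0 sb] gs] n.
  have n0 : 0 < n.+1%:R^-1 :> R by rewrite invr_gt0.
  have [dl dl0 H] := within_itv0y_dist cg s0 n0.
  have [x /andP[x0 x1] sE] : exists2 x, 0 <= x <= 1 & s = b * x.
    have [b00|bn0] := eqVneq b 0.
      by exists 0; rewrite ?lexx ?ler01// mulr0; lra.
    have bgt0 : 0 < b by rewrite lt0r bn0.
    exists (s / b); last by rewrite mulrC divfK.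
    by rewrite divr_ge0//= ler_pdivrMr// mul1r.
  (* b + 1 rather than b, since b may be 0 *)
  pose e := dl / (b + 1).
  have b1 : 0 < b + 1 by lra.
  have e0 : 0 < e by rewrite divr_gt0.
  have lt_maxmin : Num.max 0 (x - e) < Num.min 1 (x + e).
    by rewrite gt_max !lt_min; apply/andP; split; apply/andP; split; lra.
  have [q] := rat_in_itvoo lt_maxmin.
  rewrite in_itv/= gt_max lt_min => /andP[/andP[q0 qx] /andP[q1 xq]].
  exists q; first by rewrite !ltW.
  rewrite -gs; apply: H; first by rewrite mulr_ge0// ltW.
  rewrite sE -mulrBr normrM (ger0_norm b0).
  have qe : `|ratr q - x| < e by rewrite ltr_norml; apply/andP; split; lra.
  have de : e * (b + 1) = dl by rewrite /e divfK// gt_eqF.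
  have := normr_ge0 (ratr q - x); nra.
move=> Hq.
have [c cI cmin] : exists2 c, c \in `[0, b] &
    forall t, t \in `[0, b] -> `|g c - 2| <= `|g t - 2|.
  apply: (@EVT_min _ (fun t => `|g t - 2|)) => //.
  have {}cg : {within `[0, b], continuous g}.
    by apply: continuous_subspaceW cg; apply: subset_itvl; rewrite bnd_simp.
  move/subspace_continuousP: cg => cg; apply/subspace_continuousP => x Ax.
  apply: (@cvg_norm _ R^o); apply: (@cvgB _ R^o); last exact: cvg_cst.
  exact: cg.
exists c; first by rewrite in_itv/= in cI.
apply/eqP; rewrite -subr_eq0 -normr_eq0; apply/eqP/le_anti/andP; split => //.
rewrite leNgt; apply/negP => /exists_inv_natS_lt[n nc].
have [q /andP[q0 q1] gq] := Hq n.
have bq : b * ratr q \in `[0, b].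
  by rewrite in_itv/= mulr_ge0//= ler_piMr.
have := lt_trans nc (le_lt_trans (cmin _ bq) gq); by rewrite ltxx.
Qed.

Lemma measurable_hitting_time (R : realType) (disp : measure_display)
    (T : measurableType disp) (g : R -> T -> R) :
  (forall t, measurable_fun [set: T] (g t)) ->
  (forall w, {within `[0, +oo[, continuous (fun t => g t w)}) ->
  measurable_fun [set: T] (fun w => hitting_time (fun t => g t w)).
Proof.
move=> mg cg.
pose reach b := [set w | exists2 s, 0 <= s <= b & g s w = 2].
have mreach b : 0 <= b -> measurable (reach b).
  move=> b0.
  rewrite (_ : reach b = \bigcap_n \bigcup_(q : rat)
      (if 0 <= (ratr q : R) <= 1 then
         [set w | `|g (b * ratr q) w - 2| < n.+1%:R^-1] else set0)).
    apply: bigcapT_measurable => n; apply: bigcupT_measurable_rat => q.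
    case: ifP => // _.
    have mh : measurable_fun [set: T] (fun w => `|g (b * ratr q) w - 2|).
      by apply: measurableT_comp => //; exact: measurable_funB.
    rewrite -[X in measurable X]setTI.
    exact: (measurable_fun_ltr mh (measurable_cst _)).
  apply/seteqP; split => w.
    move=> /(reaches_rationally (cg w) b0) H n _; have [q q01 gq] := H n.
    by exists q => //=; rewrite q01.
  move=> H; apply/(reaches_rationally (cg w) b0) => n.
  have [q _] := H n Logic.I; case: ifP => [q01 gq|//].
  by exists q.
apply: (measurability _ (ErealGenInftyO.measurableE R)).
move=> _ [_ [r ->] <-]; rewrite setTI.
have -> : (fun w => hitting_time (g^~ w)) @^-1` [set` `]-oo, (r%:E : \bar R)[] =
    \bigcup_(b : rat)
      (if 0 <= (ratr b : R) < r then reach (ratr b) else set0); last first.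
  apply: bigcupT_measurable_rat => b; case: ifP => // /andP[b0 _].
  exact: mreach.
apply/seteqP; split => w /=.
  rewrite in_itv/= => /ereal_inf_lt[_ [s [s0 gs] <-]]; rewrite lte_fin => sr.
  have [b] := rat_in_itvoo sr; rewrite in_itv/= => /andP[sb br].
  exists b => //; have -> : 0 <= (ratr b : R) < r by apply/andP; split => //; lra.
  by exists s => //; rewrite s0 ltW.
move=> [b _]; case: ifP => // /andP[b0 br] [s /andP[s0 sb] gs].
rewrite in_itv/=; apply: le_lt_trans (_ : (s%:E < r%:E)%E).
  by apply: ereal_inf_lbound; exists s.
by rewrite lte_fin; lra.
Qed.

(** * Exit position and exit time *)

Section one_system.
Context {R : realType} {disp : measure_display} {T : measurableType disp}.
Variable P : probability T R.
Implicit Types X B : nat -> R -> {RV P >-> R}.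

Lemma measurable_exit_time_at X d i :
  (forall i w, (i <= d)%N ->
     {within `[(0 : R), +oo[, continuous (fun t : R => X i t w)}) ->
  (i <= d)%N -> measurable_fun [set: T] (exit_time_at X i).
Proof.
move=> cX id.
apply: (@measurable_hitting_time R disp T (fun t w => X i t w - X i.-1 t w)).
  by move=> t; apply: measurable_funB; exact: measurable_funPT.
move=> w; apply: within_continuousB; apply: cX => //.
exact: leq_trans (leq_pred _) id.
Qed.

Lemma measurable_exit_time X d :
  (forall i w, (i <= d)%N ->
     {within `[(0 : R), +oo[, continuous (fun t : R => X i t w)}) ->
  measurable_fun [set: T] (exit_time d X).
Proof.
move=> cX; rewrite /exit_time.
have : all (fun i => (i <= d)%N) (index_iota 1 d.+1).
  by apply/allP => i; rewrite mem_index_iota => /andP[].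
elim: (index_iota _ _) => [_|i s IH /= /andP[id sd]].
  by under eq_fun do rewrite big_nil; exact: measurable_cst.
under eq_fun do rewrite big_cons.
apply: measurable_mine; last exact: IH.
exact: measurable_exit_time_at cX id.
Qed.

Lemma exit_time_last X d (b : \bar R) w : (0 < d)%N ->
  (forall i, (0 < i < d)%N -> (b <= exit_time_at X i w)%E) ->
  (exit_time_at X d w <= b)%E -> exit_time d X w = exit_time_at X d w.
Proof.
move=> d0 Hi Hd; rewrite /exit_time big_nat_recr//=.
apply: min_idPr; apply: le_trans Hd _.
rewrite big_nat; elim/big_ind: _ => [|x y bx by_|i /Hi //]; first exact: leey.
by rewrite le_min bx.
Qed.

(** The oscillation allowed by [path_exit] on the last unit interval is
    eps th / (4 d^2), which turns the bound of [noise_small] into a multiple of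
    (sigma / eps)^4. *)
Lemma exit_holds_but d (sigma eps th eta : R) B X :
  let c := d%:R / eps - gap_delay R d d in
  (0 < d)%N -> independent_brownian_motions 1 d B ->
  particle_system d sigma eps B X ->
  0 <= sigma -> 0 < eps -> eps <= th -> 0 < eta <= 1 / 2 -> 0 <= c ->
  4 * d%:R ^+ 3 * th * (2 * d%:R ^+ 2 + 3 + gap_delay R d d) < eta ->
  holds_but P
    (d%:R * (2 * chaining_constant * (4 * d%:R ^+ 2 / th) ^+ 4)
       * (sigma / eps) ^+ 4)
    (fun w => [/\ ((c - eta)%:E <= exit_time_at X d w)%E,
                  (exit_time_at X d w < (c + eta)%:E)%E &
      forall i, (0 < i < d)%N -> ((c + eta)%:E <= exit_time_at X i w)%E]).
Proof.
move=> c d0 bm [cX /holds_but_ae Xae] s0 e0 eth etaI c0 zs.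
have th0 : 0 < th by lra.
have dn0 : d%:R != 0 :> R by rewrite pnatr_eq0 -lt0n.
have y0 : 0 < eps * th / (4 * d%:R ^+ 2).
  by rewrite divr_gt0 ?mulr_gt0 ?exprn_gt0 ?ltr0n.
have noise := @noise_small R disp T P d (Num.truncn (d%:R / eps)).+1 B sigma _ bm s0 y0.
have Bae : holds_but P (d%:R * 0) (fun w => forall i, (i < d)%N -> (0 < i)%N ->
    {within `[0, +oo[, continuous (fun t => B i t w)}).
  apply: holds_but_forall_lt => // i id.
  have [->|i0] := posnP i.
    by exists set0; split => //; rewrite measure0.
  have [_ _ _ /holds_but_ae] : standard_brownian_motion (B i).
    by case: bm => bm _; apply: bm; rewrite i0.
  exact: holds_but_impl.
apply: holds_but_impl (holds_but_and noise (holds_but_and Xae Bae)).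
  rewrite mulr0 !addr0 le_eqVlt; apply/orP; left; apply/eqP.
  by field; rewrite dn0 !gt_eqF.
move=> w [osc [[x0 xl xr xeq] cB]].
have px : particle_path d sigma eps (fun i t => X i t w) (fun i t => B i t w).
  split=> //.
    by move=> i id; exact: cX.
  by move=> i /andP[i0 id]; exact: cB.
exact: path_exit d0 px s0 e0 eth etaI c0 zs osc.
Qed.

End one_system.

(** Given the precision [eta], the noise level [th] is chosen small enough for
    [path_exit], and then [eps] small enough compared with [th]. *)
Lemma exit_near (R : realType) (d : nat) (d_ge1 : (1 <= d)%N)
    (sigma : R -> R)
    (sigma_ge0 : forall eps : R, 0 < eps -> 0 <= sigma eps)
    (disp : measure_display) (T : R -> measurableType disp)
    (P : forall eps : R, probability (T eps) R)
    (B X : forall eps : R, nat -> R -> {RV (P eps) >-> R})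
    (B_brownian : forall eps : R, 0 < eps ->
       independent_brownian_motions 1 d (B eps))
    (X_system : forall eps : R, 0 < eps ->
       particle_system d (sigma eps) eps (B eps) (X eps)) (eta : R) :
  0 < eta <= 1 / 2 ->
  exists C : R, \forall eps \near 0^'+, 0 < eps /\
    holds_but (P eps) (C * (sigma eps / eps) ^+ 4)
    (fun w : T eps => let c := d%:R / eps - gap_delay R d d in
       [/\ ((c - eta)%:E <= exit_time_at (X eps) d w)%E,
           (exit_time_at (X eps) d w < (c + eta)%:E)%E &
           forall i, (0 < i < d)%N ->
             ((c + eta)%:E <= exit_time_at (X eps) i w)%E]).
Proof.
move=> etaI; have [eta0 _] := andP etaI.
have d1 : 1 <= d%:R :> R by rewrite ler1n.
have K0 : 0 <= gap_delay R d d.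
  by rewrite gap_delay_last divr_ge0// mulr_ge0//; lra.
pose M : R := 4 * d%:R ^+ 3 * (2 * d%:R ^+ 2 + 3 + gap_delay R d d).
have M0 : 0 < M.
  rewrite mulr_gt0//; first by rewrite mulr_gt0// exprn_gt0//; lra.
  by have := exprn_ge0 2 (le_trans ler01 d1); lra.
pose th := eta / (2 * M).
have th0 : 0 < th by rewrite divr_gt0// mulr_gt0.
have thM : M * th < eta.
  by rewrite (_ : M * th = eta / 2); [lra|rewrite /th; field; rewrite gt_eqF].
have zs : 4 * d%:R ^+ 3 * th * (2 * d%:R ^+ 2 + 3 + gap_delay R d d) < eta.
  by move: thM; rewrite /M [X in X < _](_ : _ = 4 * d%:R ^+ 3 * th *
    (2 * d%:R ^+ 2 + 3 + gap_delay R d d))//; ring.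
eexists; near=> eps.
have e0 : 0 < eps by near: eps; exact: nbhs_right_gt.
split=> //.
apply: (exit_holds_but d_ge1 (B_brownian _ e0) (X_system _ e0) (sigma_ge0 _ e0) e0
  (th := th)) => //.
- by near: eps; apply: nbhs_right_le.
- have : eps <= (gap_delay R d d + 1)^-1.
    by near: eps; apply: nbhs_right_le; rewrite invr_gt0; lra.
  have K1 : 0 < gap_delay R d d + 1 by lra.
  rewrite -[_^-1]mul1r ler_pdivlMr// => h.
  rewrite subr_ge0 ler_pdivlMr//; nra.
Unshelve. all: by end_near.
Qed.

Theorem theorem1 (R : realType) (d : nat) (d_ge1 : (1 <= d)%N)
    (sigma : R -> R)
    (sigma_ge0 : forall eps : R, 0 < eps -> 0 <= sigma eps)
    (sigma_small :
       (sigma eps / eps @[eps --> 0^'+] --> (0 : R)) \/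
       (forall eps : R, 0 < eps -> sigma eps = 0))
    (disp : measure_display) (T : R -> measurableType disp)
    (P : forall eps : R, probability (T eps) R)
    (B X : forall eps : R, nat -> R -> {RV (P eps) >-> R})
    (B_brownian : forall eps : R, 0 < eps ->
       independent_brownian_motions 1 d (B eps))
    (X_system : forall eps : R, 0 < eps ->
       particle_system d (sigma eps) eps (B eps) (X eps)) :
  (forall i : nat, (1 <= i <= d)%N ->
     P eps [set w | exit_time d (X eps) w = exit_time_at (X eps) i w]
       @[eps --> 0^'+] --> (if i == d then 1 else 0)%E) /\
  cvg_in_probability_to_0 (0 : R)^'+ P
    (fun (eps : R) (w : T eps) =>
       (exit_time d (X eps) w
        - (d%:R / eps - ((d%:R - 1) * (2 * d%:R - 1)) / 6)%:E)%E).
Proof.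
have ratio : sigma eps / eps @[eps --> 0^'+] --> (0 : R).
  case: sigma_small => // s0.
  apply: cvg_near_cst; near=> eps.
  have e0 : 0 < eps by near: eps; exact: nbhs_right_gt.
  by rewrite s0// mul0r.
have bound0 (C : R) : C * (sigma eps / eps) ^+ 4 @[eps --> 0^'+] --> (0 : R).
  rewrite -[X in _ --> X](mulr0 C); apply: cvgM; first exact: cvg_cst.
  rewrite -[X in _ --> X](@expr0n _ 4 : _ = 0).
  by apply: (@cvg_comp _ _ _ _ (fun x : R => x ^+ 4) _ _ _ ratio); exact: exprn_continuous.
have mtau eps i : 0 < eps -> (i <= d)%N ->
    measurable_fun [set: T eps] (exit_time_at (X eps) i).
  by move=> e0; apply: measurable_exit_time_at; case: (X_system _ e0).
have mexit eps : 0 < eps -> measurable_fun [set: T eps] (exit_time d (X eps)).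
  by move=> e0; apply: measurable_exit_time; case: (X_system _ e0).
have meq eps i : 0 < eps -> (i <= d)%N ->
    measurable [set w | exit_time d (X eps) w = exit_time_at (X eps) i w].
  move=> e0 id; rewrite -[X in measurable X]setTI.
  by apply: measurable_eqe => //; [exact: mexit|exact: mtau].
have to0 (E : forall eps, set (T eps)) (C : R) :
    (\forall eps \near 0^'+, (P eps (E eps) <= (C * (sigma eps / eps) ^+ 4)%:E)%E) ->
    P eps (E eps) @[eps --> 0^'+] --> 0%E.
  move=> EC; apply: (@squeeze_cvge _ _ _ _ (cst 0%E) _ (fun eps => (C * (sigma eps / eps) ^+ 4)%:E)).
  - by apply: filterS EC => eps; rewrite measure_ge0.
  - exact: cvg_cst.
  - by apply: cvg_EFin; [exact: nearW|exact: bound0].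
have near_exit := exit_near d_ge1 sigma_ge0 B_brownian X_system.
have half : 0 < (1 / 2 : R) <= 1 / 2 by apply/andP; split; lra.
split.
- move=> i /andP[i0 id].
  have [C HC] := near_exit _ half.
  case: eqVneq => [iE|iNd].
    rewrite iE in id *.
    apply: (@squeeze_cvge _ _ _ _ (fun eps => (1 - C * (sigma eps / eps) ^+ 4)%:E)
      _ (cst 1%E)).
    + apply: filterS HC => eps [e0 hb]; rewrite probability_le1 ?andbT; last exact: meq.
      apply: holds_but_ge hb; first exact: meq.
      by move=> w [_ /ltW lt_d ge_i]; exact: exit_time_last d_ge1 ge_i lt_d.
    + apply: cvg_EFin; first exact: nearW.
      rewrite -[X in _ --> X]subr0; apply: cvgB; first exact: cvg_cst.
      exact: bound0.
    + exact: cvg_cst.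
  apply: (to0 (fun eps => [set w | exit_time d (X eps) w = exit_time_at (X eps) i w]) C).
  apply: filterS HC => eps [e0 hb]; apply: holds_but_le hb; first exact: meq.
  move=> w [_ lt_d ge_i] /=.
  rewrite (exit_time_last d_ge1 ge_i (ltW lt_d)) => tE.
  have iI : (0 < i < d)%N by rewrite i0 ltn_neqAle iNd.
  by have := lt_le_trans lt_d (ge_i i iI); rewrite tE ltxx.
- move=> eta eta0; pose eta' := Num.min eta (1 / 2).
  have eta'I : 0 < eta' <= 1 / 2.
    by rewrite lt_min eta0/= ge_min lexx orbT andbT; lra.
  have eta'le : eta' <= eta by rewrite ge_min lexx.
  have [C HC] := near_exit _ eta'I.
  apply: (to0 (fun eps => [set w | (eta%:E < `|exit_time d (X eps) w -
    (d%:R / eps - (d%:R - 1) * (2 * d%:R - 1) / 6)%:E|)%E]) C).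
  apply: filterS HC => eps [e0 hb].
  rewrite -gap_delay_last.
  apply: holds_but_le hb.
    rewrite -[X in measurable X]setTI.
    apply: emeasurable_fun_o_infty => //.
    apply: measurableT_comp => //.
    apply: emeasurable_funB => //; exact: mexit.
  move=> w [ge_d lt_d ge_i] /=; apply/negP; rewrite -leNgt.
  rewrite (exit_time_last d_ge1 ge_i (ltW lt_d)).
  move: ge_d lt_d; case: (exit_time_at (X eps) d w) => [r| |] //=.
  rewrite !lee_fin lte_fin => r1 r2; rewrite ler_norml; apply/andP; split; lra.
Unshelve. all: by end_near.
Qed.
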